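(* Let $d\geq 2$ and $k\geq 2$ be integers. If $\mathbf{C}_{\mathbf{o}}$ is an $\mathbf{o}$-symmetric affine $d$-cube of $\mathbb{R}^d$, then $g_k(\mathbb{M}^d_{\mathbf{C}_{\mathbf{o}}})=k\cdot 2^{d-1}$.
   Context: For a convex body $\mathbf{K}_{\mathbf{o}}\subset\mathbb{R}^d$ symmetric about the origin $\mathbf{o}$ (compact, convex, nonempty interior), let $\|\mathbf{x}\|_{\mathbf{K}_{\mathbf{o}}}=\min\{\lambda\geq 0 : \mathbf{x}\in\lambda\mathbf{K}_{\mathbf{o}}\}$, and let $\mathbb{M}^d_{\mathbf{K}_{\mathbf{o}}}$ denote $\mathbb{R}^d$ equipped with this norm. An affine $d$-cube is the image of $[0,1]^d$ under an invertible affine map of $\mathbb{R}^d$; it is $\mathbf{o}$-symmetric if its center is $\mathbf{o}$. A finite set $X$ of (distinct) points, of positive diameter in $\mathbb{M}^d_{\mathbf{K}_{\mathbf{o}}}$, is a $k$-diametral point set in $\mathbb{M}^d_{\mathbf{K}_{\mathbf{o}}}$ if any $k$ distinct points of $X$ include two points whose $\|\cdot\|_{\mathbf{K}_{\mathbf{o}}}$-distance equals the diameter of $X$. $g_k(\mathbb{M}^d_{\mathbf{K}_{\mathbf{o}}})$ is the largest cardinality of a $k$-diametral point set in $\mathbb{M}^d_{\mathbf{K}_{\mathbf{o}}}$. *)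

(* Defs.v *)
(* MathComp / MathComp-Analysis *)
From HB Require Import structures.
From mathcomp Require Import all_boot all_order all_algebra.
From mathcomp Require Import finmap.
From mathcomp Require Import boolp classical_sets reals.
Set Implicit Arguments.
Unset Strict Implicit.
Unset Printing Implicit Defensive.
Import Order.TTheory GRing.Theory Num.Theory.
Local Open Scope classical_set_scope.
Local Open Scope ring_scope.

(* Points of R^d are row vectors, so a linear map acts as x |-> x *m A. *)

Definition unit_cube (R : realType) (d : nat) : set 'rV[R]_d :=
  [set x | forall i, 0 <= x 0 i <= 1].

Definition affine_cube (R : realType) (d : nat) (C : set 'rV[R]_d) : Prop :=
  exists (A : 'M[R]_d) (b : 'rV[R]_d),
    A \in unitmx /\ C = [set x *m A + b | x in @unit_cube R d].

Definition centered_at (R : realType) (d : nat) (c : 'rV[R]_d)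
    (C : set 'rV[R]_d) : Prop :=
  forall x, C x -> C (c *+ 2 - x).

Definition o_symmetric (R : realType) (d : nat) (C : set 'rV[R]_d) : Prop :=
  centered_at 0 C.

Definition is_min (R : realType) (S : set R) (m : R) : Prop :=
  S m /\ lbound S m.

(* The minimum exists, so that the default value 0 is not used, whenever K is
   an origin-symmetric convex body. *)
Definition body_norm (R : realType) (d : nat) (K : set 'rV[R]_d)
    (x : 'rV[R]_d) : R :=
  xget 0 [set m | is_min
    [set l : R | 0 <= l /\ [set l *: y | y in K] x] m].

Definition body_dist (R : realType) (d : nat) (K : set 'rV[R]_d)
    (x y : 'rV[R]_d) : R :=
  body_norm K (x - y).

Definition diam (R : realType) (d : nat) (K : set 'rV[R]_d)
    (X : {fset 'rV[R]_d}) : R :=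
  sup [set body_dist K x y | x in [set` X] & y in [set` X]].

Definition k_diametral (R : realType) (d : nat) (K : set 'rV[R]_d) (k : nat)
    (X : {fset 'rV[R]_d}) : Prop :=
  0 < diam K X /\
  forall Y : {fset 'rV[R]_d}, (Y `<=` X)%fset -> #|` Y| = k ->
    exists x y, [/\ x \in Y, y \in Y, x != y & body_dist K x y = diam K X].

(* [is_g K k n] reads: g_k of R^d normed by K is equal to n; in particular the
   largest cardinality exists and is attained. *)
Definition is_g (R : realType) (d : nat) (K : set 'rV[R]_d) (k n : nat) :
    Prop :=
  (exists X, k_diametral K k X /\ #|` X| = n) /\
  (forall X, k_diametral K k X -> (#|` X| <= n)%N).

(* Main.v *)
(* The norm of C is a maximum norm in the coordinates x *m B.  A diametral pair
   differs by exactly the diameter in some coordinate, where one point lies at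
   the bottom and the other at the top of the range of X.  For each vertex v of
   the cube, the points that never lie at the end opposite to v contain no
   diametral pair, hence number at most k - 1, and at most one of them lies at
   an end in every coordinate.  A point with s coordinates strictly inside the
   range is compatible with 2 ^ s vertices, so giving weight 2 to the points
   without interior coordinate and summing over the 2 ^ d vertices yields
   2 * #X <= k * 2 ^ d.  Equality holds for {0, 1} ^ (d - 1) times k equally
   spaced points of [0, 1]. *)
Require Import Defs.
From HB Require Import structures.
From mathcomp Require Import all_boot all_order all_algebra.
From mathcomp Require Import finmap.
From mathcomp Require Import boolp classical_sets reals.
From mathcomp Require Import zify lra.
Set Implicit Arguments.
Unset Strict Implicit.
Unset Printing Implicit Defensive.

Import Order.TTheory GRing.Theory Num.Theory.
Local Open Scope ring_scope.

(** * Maximum norm and the norm of an affine cube *)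

Lemma sub_mxE (V : zmodType) (m n : nat) (A B : 'M[V]_(m, n)) i j :
  (A - B) i j = A i j - B i j.
Proof. by rewrite !mxE. Qed.

Definition maxnorm (R : realType) (d : nat) (x : 'rV[R]_d) : R :=
  \big[Order.max/0]_i `|x 0 i|.

Lemma maxnorm_leP (R : realType) (d : nat) (x : 'rV[R]_d) (a : R) :
  0 <= a -> maxnorm x <= a <-> forall i, `|x 0 i| <= a.
Proof.
move=> a0; split=> [/bigmax_leP[_ h] i|h]; first exact: h.
by apply/bigmax_leP; split.
Qed.

Lemma maxnorm_ge0 (R : realType) (d : nat) (x : 'rV[R]_d) : 0 <= maxnorm x.
Proof. exact: bigmax_ge_id. Qed.

Lemma le_maxnorm (R : realType) (d : nat) (x : 'rV[R]_d) i :
  `|x 0 i| <= maxnorm x.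
Proof. exact: (le_bigmax _ (fun i => `|x 0 i|)). Qed.

(** Positivity excludes the initial value [0] of the maximum, the only candidate that need not come
    from a coordinate. *)
Lemma maxnorm_attained (R : realType) (d : nat) (x : 'rV[R]_d) :
  0 < maxnorm x -> exists i, maxnorm x = `|x 0 i|.
Proof.
move=> x0; case: (pselect (exists i, maxnorm x = `|x 0 i|)) => // /forallNP h.
suff: maxnorm x < maxnorm x by rewrite ltxx.
apply/bigmax_ltP; split=> // i _.
by rewrite lt_neqAle le_maxnorm andbT; apply/eqP => e; apply: (h i).
Qed.

Lemma o_symmetric_cubeP (R : realType) (d : nat) (A : 'M[R]_d) (b : 'rV[R]_d) :
  A \in unitmx ->
  o_symmetric [set x *m A + b | x in @unit_cube R d]%classic ->
  forall x, [set x *m A + b | x in @unit_cube R d]%classic x <->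
            maxnorm (x *m (2 *: invmx A)) <= 1.
Proof.
move=> uA; set C := image _ _ => hsym; pose c := b *m invmx A.
have CP x : C x <-> forall i, 0 <= (x *m invmx A) 0 i - c 0 i <= 1.
  split=> [[u hu <-] i|h].
    by rewrite mulmxDl mulmxK // mxE addrK; apply: hu.
  exists ((x - b) *m invmx A); last by rewrite mulmxKV ?subrK.
  by move=> i; have := h i; rewrite mulmxBl !mxE.
(* Reflecting the two opposite vertices [b] and [b + const_mx 1 *m A] gives both inequalities for
   [c 0 i]. So [C] is the image of [-1/2, 1/2]^d under [A], whence the factor 2 in front of
   [invmx A]. *)
have cE i : c 0 i = - 2^-1.
  have /hsym/CP/(_ i) : C b by apply/CP => j; rewrite subrr lexx ler01.
  have /hsym/CP/(_ i) : C (b + const_mx 1 *m A).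
    apply/CP => j; rewrite mulmxDl mulmxK // !mxE.
    by rewrite addrAC subrr add0r ler01 lexx.
  rewrite mul0rn !sub0r !mulNmx mulmxDl mulmxK // -/c !mxE; lra.
move=> x; rewrite CP maxnorm_leP // -scalemxAr.
by split=> h i; move: (h i); rewrite cE !mxE ler_norml; lra.
Qed.

Lemma is_min_unique (R : realType) (S : set R) : is_subset1 (is_min S).
Proof.
move=> x y [Sx lx] [Sy ly]; apply/eqP; rewrite eq_le.
by rewrite (lx _ Sy) (ly _ Sx).
Qed.

(** The dilate of [K] by [l] is the ball of radius [l], so the least admissible [l] is the norm
    itself. *)
Lemma body_norm_maxnorm (R : realType) (d : nat) (K : set 'rV[R]_d)
    (B : 'M[R]_d) : B \in unitmx ->
  (forall x, K x <-> maxnorm (x *m B) <= 1) ->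
  forall x, body_norm K x = maxnorm (x *m B).
Proof.
move=> uB KP x; apply: xget_subset1; last exact: is_min_unique.
have dilateP l : (0 <= l /\ [set l *: y | y in K]%classic x) <->
    maxnorm (x *m B) <= l.
  split=> [[l0 [y /KP Ky <-]]|xl].
    apply/maxnorm_leP => // i; rewrite -scalemxAl mxE normrM (ger0_norm l0).
    by rewrite ler_piMr // (le_trans (le_maxnorm _ _)).
  have l0 := le_trans (maxnorm_ge0 _) xl; split=> //.
  (* For [l = 0] no rescaling by [l^-1] is possible; there invertibility of [B] forces [x = 0]. *)
  move: l0; rewrite le_eqVlt => /predU1P[l0|l0].
    exists 0.
      by apply/KP/maxnorm_leP => // i; rewrite mul0mx mxE normr0 ler01.
    rewrite scaler0; apply: (can_inj (mulmxK uB)); apply/rowP => i.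
    apply/eqP; rewrite mul0mx mxE eq_sym -normr_le0 l0.
    exact: le_trans (le_maxnorm _ _) xl.
  exists (l^-1 *: x); last by rewrite scalerA divff ?scale1r ?gt_eqF.
  apply/KP/maxnorm_leP => // i; rewrite -scalemxAl mxE normrM gtr0_norm ?invr_gt0 //.
  by rewrite ler_pdivrMl // mulr1 (le_trans (le_maxnorm _ _)).
by split=> [|l /dilateP//]; apply/dilateP.
Qed.

Lemma cube_norm (R : realType) (d : nat) (C : set 'rV[R]_d) :
  affine_cube C -> o_symmetric C ->
  exists2 B : 'M[R]_d, B \in unitmx &
    forall x, body_norm C x = maxnorm (x *m B).
Proof.
move=> [A [b [uA ->]]] hsym; exists (2 *: invmx A).
  by rewrite unitmxZ ?unitmx_inv // unitfE pnatr_eq0.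
apply: body_norm_maxnorm; last exact: o_symmetric_cubeP.
by rewrite unitmxZ ?unitmx_inv // unitfE pnatr_eq0.
Qed.

(** * Weighted double counting over the vertices of the cube *)

Lemma card_conflict_le (I T : finType) (lo hi : T -> I -> bool) (k : nat) :
  (forall x i, ~~ (lo x i && hi x i)) ->
  (forall x y, (forall i, (lo x i && lo y i) || (hi x i && hi y i)) -> x = y) ->
  (forall S : {set T}, #|S| = k ->
     exists x y i, [/\ x \in S, y \in S, lo x i & hi y i]) ->
  (2 * #|T| <= k * 2 ^ #|I|)%N.
Proof.
move=> disj inj conf.
pose compat (x : T) (v : {ffun I -> bool}) :=
  [forall i, (lo x i ==> ~~ v i) && (hi x i ==> v i)].
pose total x := [forall i, lo x i || hi x i].
pose weight (x : T) v := (if compat x v then 1 + total x else 0)%N.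
(* A total point gets 2 from the vertex [v0] alone. Otherwise flipping [v0] at a coordinate [j]
   where [x] is at neither end gives a second compatible vertex, and two vertices suffice. *)
have weight_ge x : (2 <= \sum_v weight x v)%N.
  pose v0 := [ffun i => hi x i].
  have c0 : compat x v0.
    by apply/forallP => i; rewrite ffunE; have := disj x i; case: (lo x i) (hi x i) => [] [].
  rewrite (bigD1 v0) //= {1}/weight c0.
  case: (boolP (total x)) => [_|]; first by rewrite leq_addr.
  rewrite negb_forall => /existsP[j]; rewrite negb_or => /andP[nl nh].
  pose v1 := [ffun i => if i == j then true else hi x i].
  have c1 : compat x v1.
    apply/forallP => i; rewrite ffunE; have := disj x i.
    by case: eqP => [->|_]; [rewrite (negPf nl) (negPf nh)|case: (lo x i) (hi x i) => [] []].
  have v10 : v1 != v0.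
    by apply/eqP => /ffunP/(_ j); rewrite !ffunE eqxx (negPf nh).
  by rewrite (bigD1 v1) //= {1}/weight c1; lia.
have weight_le v : (\sum_x weight x v <= k)%N.
  pose S := [set x | compat x v].
  have -> : (\sum_x weight x v = #|S| + #|[set x in S | total x]|)%N.
    rewrite -!sum1_card [in RHS]big_mkcond /= [X in (_ + X)%N]big_mkcond /=.
    rewrite -big_split /=; apply: eq_bigr => x _.
    by rewrite !inE /weight; case: (compat x v) (total x) => [] [].
  (* Among [k] points of [S] one would be low and one high at the same [i], requiring [v i] to be
     both false and true. *)
  have S_lt : (#|S| < k)%N.
    rewrite ltnNge; apply/negP => /card_geqP[s [us sk sS]].
    have [|x [y [i [xs ys lx hy]]]] := conf [set x in s].
      by rewrite cardsE (card_uniqP us).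
    rewrite !inE in xs ys; have := sS _ xs; have := sS _ ys; rewrite !inE.
    move=> /forallP/(_ i) + /forallP/(_ i).
    by rewrite lx hy; case: (v i); rewrite ?andbF.
  suff: (#|[set x in S | total x]| <= 1)%N by move=> h; rewrite -addn1 in S_lt; lia.
  (* A total point of [S] lies in every coordinate at the end prescribed by [v], so two of them
     share all ends. *)
  apply/card_le1_eqP => x y; rewrite !inE.
  move=> /andP[/forallP cx /forallP tx] /andP[/forallP cy /forallP ty].
  apply: inj => i; move: (cx i) (tx i) (cy i) (ty i).
  by case: (v i) (lo x i) (hi x i) (lo y i) (hi y i) => [] [] [] [] [].
apply: (@leq_trans (\sum_(x : T) \sum_v weight x v)).
  by rewrite mulnC -sum_nat_const leq_sum.
have <- : #|{ffun I -> bool}| = (2 ^ #|I|)%N by rewrite card_ffun card_bool.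
rewrite exchange_big /= mulnC -sum_nat_const.
exact: leq_sum.
Qed.

(** * Diameter and upper bound *)

Lemma le_diam (R : realType) (d : nat) (K : set 'rV[R]_d)
    (X : {fset 'rV[R]_d}) x y :
  x \in X -> y \in X -> body_dist K x y <= diam K X.
Proof.
move=> xX yX; apply: ub_le_sup; last by exists x => //; exists y.
(* Finiteness of [X] bounds the set of distances, so [sup] is a genuine supremum. *)
exists (\big[Order.max/0]_(p : X * X) body_dist K (val p.1) (val p.2)).
move=> _ [u /= uX [v /= vX <-]].
exact: (le_bigmax _ (fun p : X * X => body_dist K (val p.1) (val p.2))
          ([` uX], [` vX])%fset).
Qed.

Lemma diam_eq (R : realType) (d : nat) (K : set 'rV[R]_d)
    (X : {fset 'rV[R]_d}) x y :
  x \in X -> y \in X ->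
  (forall u v, u \in X -> v \in X -> body_dist K u v <= body_dist K x y) ->
  diam K X = body_dist K x y.
Proof.
move=> xX yX h; apply/eqP; rewrite eq_le le_diam // andbT.
apply: ge_sup; first by exists (body_dist K x y); exists x => //; exists y.
by move=> _ [u /= uX [v /= vX <-]]; apply: h.
Qed.

(* A point is low (high) in direction i when another point of X lies exactly one
   diameter above (below) it in the i-th coordinate; all low points then share
   their i-th coordinate, and so do all high points. *)
Lemma k_diametral_card_le (R : realType) (d k : nat) (K : set 'rV[R]_d)
    (B : 'M[R]_d) : B \in unitmx ->
  (forall x, body_norm K x = maxnorm (x *m B)) ->
  forall X, k_diametral K k X -> (2 * #|` X| <= k * 2 ^ d)%N.
Proof.
move=> uB normK X [D0 diamX]; set D := diam K X in D0 diamX.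
pose c (x : X) (i : 'I_d) : R := (val x *m B) 0 i.
have cE x y i : (val x *m B - val y *m B) 0 i = c x i - c y i.
  by rewrite sub_mxE.
have c_le x y i : `|c x i - c y i| <= D.
  have := le_diam K (valP x) (valP y); rewrite /body_dist normK mulmxBl.
  by apply: le_trans; rewrite -cE le_maxnorm.
pose lo x i := [exists z, c z i == c x i + D].
pose hi x i := [exists z, c x i == c z i + D].
rewrite cardfE -[X in (2 ^ X)%N]card_ord; apply: (@card_conflict_le _ _ lo hi).
(* A point both low and high would leave [z] and [t] differing by [2 * D] in coordinate [i]. *)
- move=> x i; apply/negP => /andP[/existsP[z /eqP zx] /existsP[t /eqP xt]].
  by have := c_le z t i; rewrite ler_norml; lra.
- move=> x y h; apply/val_inj/(can_inj (mulmxK uB))/rowP => i.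
  rewrite -/(c x i) -/(c y i).
  case/orP: (h i) => /andP[/existsP[z /eqP zx] /existsP[t /eqP ty]].
    by have := c_le z y i; have := c_le t x i; rewrite !ler_norml; lra.
  by have := c_le x t i; have := c_le y z i; rewrite !ler_norml; lra.
move=> S Sk; pose Y := [fset val x | x in S]%fset.
have YX : (Y `<=` X)%fset by apply/fsubsetP => _ /imfsetP[x _ ->]; apply: valP.
have Yk : #|` Y| = k by rewrite card_imfset -?cardE //; apply: val_inj.
have [_ [_ [/imfsetP[x /= xS ->] /imfsetP[y /= yS ->] _]]] := diamX Y YX Yk.
rewrite /body_dist normK mulmxBl => nD.
have [|i] := @maxnorm_attained _ _ (val x *m B - val y *m B); first by rewrite nD.
rewrite nD cE; case: (ger0P (c x i - c y i)) => _ De.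
  exists y, x, i; split=> //; apply/existsP; [exists x|exists y];
  apply/eqP; lra.
exists x, y, i; split=> //; apply/existsP; [exists y|exists x]; apply/eqP; lra.
Qed.

(** * Extremal configuration *)

Definition grid_point (R : realType) (d k : nat)
    (p : {ffun 'I_d -> bool} * 'I_k.+2) : 'rV[R]_d.+1 :=
  (* The [k.+2] values along axis [ord0] have spacing 1/(k+1), so the first is 0 and the last is
     1. *)
  \row_i if unlift ord0 i is Some j then (p.1 j)%:R else p.2%:R / k.+1%:R.

Lemma grid_point0 (R : realType) (d k : nat)
    (p : {ffun 'I_d -> bool} * 'I_k.+2) :
  grid_point R p 0 ord0 = p.2%:R / k.+1%:R.
Proof. by rewrite mxE unlift_none. Qed.

Lemma grid_point_lift (R : realType) (d k : nat)
    (p : {ffun 'I_d -> bool} * 'I_k.+2) j :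
  grid_point R p 0 (lift ord0 j) = (p.1 j)%:R.
Proof. by rewrite mxE liftK. Qed.

Lemma grid_point_inj (R : realType) (d k : nat) :
  injective (@grid_point R d k).
Proof.
move=> [v a] [w b] /rowP e; congr pair.
  apply/ffunP => j; have := e (lift ord0 j).
  by rewrite !grid_point_lift => /eqP; rewrite eqr_nat /=; case: (v j) (w j) => [] [].
apply/val_inj/eqP; rewrite -(eqr_nat R); apply/eqP.
have := e ord0; rewrite !grid_point0 /=.
by move=> /divIf -> //; rewrite pnatr_eq0.
Qed.

Lemma grid_point_itv (R : realType) (d k : nat)
    (p : {ffun 'I_d -> bool} * 'I_k.+2) i :
  0 <= grid_point R p 0 i <= 1.
Proof.
case: (unliftP ord0 i) => [j ->|->]; rewrite ?grid_point_lift ?grid_point0.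
  by case: (p.1 j); rewrite ?lexx ler01.
rewrite divr_ge0 ?ler0n //= ler_pdivrMr ?ltr0n // mul1r ler_nat.
exact: ltn_ord p.2.
Qed.

Lemma maxnorm_grid_le (R : realType) (d k : nat)
    (p q : {ffun 'I_d -> bool} * 'I_k.+2) :
  maxnorm (grid_point R p - grid_point R q) <= 1.
Proof.
apply/maxnorm_leP => // i; rewrite sub_mxE.
have := grid_point_itv R p i; have := grid_point_itv R q i.
by rewrite ler_norml; lra.
Qed.

Lemma maxnorm_grid_eq1 (R : realType) (d k : nat)
    (p q : {ffun 'I_d -> bool} * 'I_k.+2) i :
  `|grid_point R p 0 i - grid_point R q 0 i| = 1 ->
  maxnorm (grid_point R p - grid_point R q) = 1.
Proof.
move=> e; apply/eqP; rewrite eq_le maxnorm_grid_le -[X in X <= _]e.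
by have := le_maxnorm (grid_point R p - grid_point R q) i;
  rewrite sub_mxE.
Qed.

(* A fiber of the projection to the boolean coordinates has only k.+2 points,
   so k.+2 points in one fiber include its two ends. *)
Lemma grid_point_far_pair (R : realType) (d k : nat)
    (S : {set {ffun 'I_d -> bool} * 'I_k.+2}) :
  #|S| = k.+2 -> exists p q, [/\ p \in S, q \in S &
    maxnorm (grid_point R p - grid_point R q) = 1].
Proof.
move=> Sk.
case: (pselect (exists p q, [/\ p \in S, q \in S & p.1 != q.1])) => [|h].
  move=> [p [q [pS qS pq]]]; exists p, q; split=> //.
  have [j pqj] : exists j, p.1 j != q.1 j.
    apply/existsP; apply: contraNT pq; rewrite negb_exists => /forallP pq.
    by apply/eqP/ffunP => j; apply/eqP; have := pq j; rewrite negbK.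
  apply: (@maxnorm_grid_eq1 _ _ _ _ _ (lift ord0 j)); rewrite !grid_point_lift.
  by case: (p.1 j) (q.1 j) pqj => [] [] // _;
    rewrite ?subr0 ?sub0r ?normrN normr1.
have S1 p q : p \in S -> q \in S -> p.1 = q.1.
  by move=> pS qS; apply/eqP/negP => /negP pq; apply: h; exists p, q.
have sndT : snd @: S = [set: 'I_k.+2].
  apply/eqP; rewrite eqEcard finset.subsetT cardsT card_ord card_in_imset ?Sk ?leqnn //.
  by move=> [v a] [w b] pS qS /= ->; congr pair; apply: (S1 _ _ pS qS).
have /imsetP[p pS p0] : ord0 \in snd @: S by rewrite sndT inE.
have /imsetP[q qS q1] : ord_max \in snd @: S by rewrite sndT inE.
exists p, q; split=> //; apply: (@maxnorm_grid_eq1 _ _ _ _ _ ord0).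
by rewrite !grid_point0 -p0 -q1 mul0r sub0r normrN divff ?normr1 // pnatr_eq0.
Qed.

(** Multiplication by [invmx B] carries the grid isometrically from the maximum norm to the norm of
    [K]. *)
Lemma k_diametral_grid (R : realType) (d k : nat) (K : set 'rV[R]_d.+1)
    (B : 'M[R]_d.+1) : B \in unitmx ->
  (forall x, body_norm K x = maxnorm (x *m B)) ->
  exists X, k_diametral K k.+2 X /\ #|` X| = (k.+2 * 2 ^ d)%N.
Proof.
move=> uB normK.
pose g (p : {ffun 'I_d -> bool} * 'I_k.+2) := grid_point R p *m invmx B.
have g_inj : injective g.
  by move=> p q /(can_inj (mulmxKV uB))/grid_point_inj.
have distg p q : body_dist K (g p) (g q) =
    maxnorm (grid_point R p - grid_point R q).
  by rewrite /body_dist normK mulmxBl !mulmxKV.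
pose T : finType := ({ffun 'I_d -> bool} * 'I_k.+2)%type.
pose X := [fset g p | p in T]%fset.
have gX p : g p \in X by apply/imfsetP; exists p.
have diamX : diam K X = 1.
  pose p0 : T := ([ffun=> false], ord0).
  pose p1 : T := ([ffun=> false], ord_max).
  have d01 : body_dist K (g p0) (g p1) = 1.
    rewrite distg; apply: (@maxnorm_grid_eq1 _ _ _ _ _ ord0).
    by rewrite !grid_point0 mul0r sub0r normrN divff ?normr1 // pnatr_eq0.
  rewrite (@diam_eq _ _ _ _ (g p0) (g p1)) //.
  move=> _ _ /imfsetP[p _ ->] /imfsetP[q _ ->].
  by rewrite d01 distg maxnorm_grid_le.
exists X; split; last first.
  by rewrite card_imfset //= -cardE card_prod card_ffun card_bool !card_ord mulnC.
split; first by rewrite diamX ltr01.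
move=> Y /fsubsetP YX Yk; pose S : {set T} := [set p | g p \in Y].
have Sk : #|S| = k.+2.
  rewrite -Yk; have -> : Y = [fset g p | p in S]%fset.
    apply/fsetP => y; apply/idP/imfsetP => [yY|[p /=]]; last first.
      by rewrite inE => pY ->; exact: pY.
    have /imfsetP[p _ yE] := YX _ yY.
    by exists p => //=; rewrite inE -yE.
  by rewrite card_imfset //= -cardE.
have [p [q [pS qS pq]]] := grid_point_far_pair R Sk.
have pY : g p \in Y by move: pS; rewrite inE.
have qY : g q \in Y by move: qS; rewrite inE.
exists (g p), (g q); split=> //; last by rewrite distg diamX.
(* The far pair is distinct because its distance is 1, not 0. *)
apply/eqP => /g_inj e; move: pq; rewrite e subrr => /eqP.
apply/negP; rewrite lt_eqF // (@le_lt_trans _ _ 0) ?ltr01 //.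
by apply/maxnorm_leP => // i; rewrite mxE normr0.
Qed.

Theorem theorem9 (R : realType) (d k : nat) (hd : (2 <= d)%N) (hk : (2 <= k)%N)
    (C : set 'rV[R]_d) (hC : affine_cube C) (hsym : o_symmetric C) :
  is_g C k (k * 2 ^ (d - 1))%N.
Proof.
have [B uB normC] := cube_norm hC hsym.
split.
  case: d hd C hC hsym B uB normC => [//|d] _ C _ _ B uB normC.
  case: k hk => [|[|k]] // _; rewrite subn1 /=.
  exact: k_diametral_grid uB normC.
(* With [d] replaced by its successor, [2 ^ d] splits off the factor 2 that cancels. *)
move=> X /(k_diametral_card_le uB normC); case: d hd {C hC hsym B uB normC} X => [//|d] _ X.
by rewrite subn1 /= expnS; lia.
Qed.
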